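(* For all umbrae $\alpha,\gamma,\delta$ and every $n\ge 0$, \[ (\delta+\gamma)^n\simeq\sum_{k=0}^n\binom{n}{k}(\delta+k\boldsymbol{\cdot}\alpha)^{n-k}\,\gamma(\gamma-k\boldsymbol{\cdot}\alpha)^{k-1}, \] where the $k=0$ summand is $\delta^n$ (i.e. $\gamma(\gamma-0\boldsymbol{\cdot}\alpha)^{-1}$ is read as $1$).
   Context: Umbral calculus setting. Fix a finite set $\mathbf{x}$ of commuting variables and a further variable $z$. To every formal power series $f(z)\in\mathbb{C}[\mathbf{x}][[z]]$ with $f(0)=1$ a symbol (its umbra) is attached. The evaluation $E$ is the $\mathbb{C}[\mathbf{x}]$-linear functional on polynomials in umbrae with coefficients in $\mathbb{C}[\mathbf{x}]$ such that $E[\alpha^n]=n![z^n]f(z)$ when $\alpha$ is the umbra of $f$, and $E[\alpha^n\gamma^m\cdots\delta^l]=E[\alpha^n]E[\gamma^m]\cdots E[\delta^l]$ whenever $\alpha,\gamma,\dots,\delta$ are pairwise distinct umbrae (uncorrelation). Write $\mathbf p\simeq\mathbf q$ if $E[\mathbf p]=E[\mathbf q]$, and $\mathbf p\equiv\mathbf q$ if $\mathbf p^n\simeq\mathbf q^n$ for all $n\ge 0$. For an umbral polynomial $\mathbf p$ let $f_{\mathbf p}(z)=E[e^{\mathbf p z}]$. Auxiliary umbrae (treated as further umbrae, uncorrelated with all other distinct umbrae): the dot-product umbra $\mathbf p\boldsymbol{\cdot}\mathbf q$ has $f_{\mathbf p\boldsymbol{\cdot}\mathbf q}(z)=f_{\mathbf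 p}(\log f_{\mathbf q}(z))$; in particular for a scalar $a$ (e.g. $a=\pm k$), $f_{a\boldsymbol{\cdot}\alpha}(z)=f_\alpha(z)^a$, and for a positive integer $k$, $k\boldsymbol{\cdot}\alpha\equiv\alpha'+\cdots+\alpha^{(k)}$ with distinct umbrae similar to $\alpha$. The expression $\gamma-k\boldsymbol{\cdot}\alpha$ means $\gamma+(-k\boldsymbol{\cdot}\alpha)$. Distinct letters denote distinct (uncorrelated) umbrae. *)

(* Defs.v *)
From HB Require Import structures.
From mathcomp Require Import all_boot all_order all_algebra.
From mathcomp Require Import finmap boolp.
From mathcomp.multinomials Require Import monalg.

Set Implicit Arguments.
Unset Strict Implicit.
Unset Printing Implicit Defensive.

Import GRing.Theory.
Local Open Scope ring_scope.

Section Umbral.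
(* The intended instance is F = C and K = C[x]. *)
Variables (F : fieldType) (K : comAlgType F).

(* A formal power series is its sequence of coefficients, f n = [z^n] f. *)
Definition fps_mul (f g : nat -> K) : nat -> K :=
  fun n => \sum_(i < n.+1) f i * g (n - i)%N.

Definition fps_one : nat -> K := fun n => (n == 0%N)%:R.

Definition fps_exp (f : nat -> K) (j : nat) : nat -> K :=
  iter j (fps_mul f) fps_one.

(* f(g(z)), meaningful only if g(0) = 0: then [z^n] g^j = 0 for j > n. *)
Definition fps_comp (f g : nat -> K) : nat -> K :=
  fun n => \sum_(j < n.+1) f j * fps_exp g j n.

(* log g(z) for g(0) = 1, by substituting g - 1 in
   log(1 + z) = \sum_(j >= 1) (-1)^(j - 1) z^j / j *)
Definition fps_log (g : nat -> K) : nat -> K :=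
  fps_comp (fun j => if j is j'.+1 then ((-1) ^+ j' / j%:R : F)%:A else 0)
           (fun n => g n - fps_one n).

Record alphabet := Alphabet {
  umbra :> choiceType;
  genf : umbra -> nat -> K;
  genf0 : forall u, genf u 0%N = 1
}.

(* Umbral polynomials: the commutative polynomials over C[x] in the umbrae *)
Local Notation upoly A := {malg K[{cmonom (umbra A)}]}.

Definition uvar (A : alphabet) (u : A) : upoly A := << ucm u >>.

(* The C[x]-linear functional sending the monomial \prod_u u^(w u) to
   \prod_u (w u)! [z^(w u)] f_u. *)
Definition ueval (A : alphabet) : upoly A -> K :=
  mmap idfun (fun w : {cmonom A} =>
    \prod_(u <- finsupp w) ((w u)`!%:R * genf u (w u))).

Lemma ueval_mono (A : alphabet) (w : {cmonom A}) :
  ueval (<< w >>) = \prod_(u <- finsupp w) ((w u)`!%:R * genf u (w u)).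
Proof. by rewrite /ueval mmapU mul1r. Qed.

Lemma ueval_linear (A : alphabet) c (p q : upoly A) :
  ueval (c *: p + q) = c * ueval p + ueval q.
Proof.
rewrite /ueval mmapD; congr (_ + _).
rewrite (mmapEw (msuppZ_le _ _)) mmapE big_distrr /=.
by apply/eq_bigr=> k _; rewrite mcoeffZ mulrA.
Qed.

Lemma ueval_uvarX (A : alphabet) (u : A) n :
  ueval (uvar u ^+ n) = n`!%:R * genf u n.
Proof.
have -> : uvar u ^+ n = << mkcmonom [fsfun [fsfun] with u |-> n] >>.
  elim: n => [|n IH].
    rewrite expr0; congr (<< _ >>); apply/eqP/cmP => v.
    by rewrite cmE /= cm1 fsfun_withE fsfun0E; case: eqP.
  rewrite exprS IH /uvar.
  rewrite malgM_def fgmulUU mulr1; congr (<< _ >>); apply/eqP/cmP => v.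
  rewrite cmM cmU !cmE /= !fsfun_withE fsfun0E eq_sym; case: eqP => //.
rewrite ueval_mono.
case: n => [|n].
  rewrite big1_fset => [|v]; first by rewrite genf0 mulr1.
  by rewrite -cmE_neq0 !cmE /= fsfun_withE fsfun0E if_same eqxx.
rewrite (_ : finsupp _ = [fset u]%fset); last first.
  apply/fsetP => v; rewrite -cmE_neq0 !cmE /= fsfun_withE fsfun0E in_fset1.
  by case: (v == u).
by rewrite big_seq_fset1 cmE /= fsfun_withE eqxx.
Qed.

Lemma ueval_uncorrelated (A : alphabet) (v w : {cmonom A}) :
  [disjoint finsupp v & finsupp w]%fset ->
  ueval (<< v >> * << w >>) = ueval << v >> * ueval << w >>.
Proof.
move=> dvw.
have -> : << v >> * << w >> = << mmul v w >> :> upoly A.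
  by rewrite malgM_def fgmulUU mulr1.
apply: (etrans (ueval_mono (mmul v w))).
apply: esym; apply: (etrans (congr2 _ (ueval_mono v) (ueval_mono w))).
rewrite (mdomD v w); apply: esym.
rewrite (perm_big (finsupp v ++ finsupp w)) /=; last first.
  apply: uniq_perm; rewrite ?cat_uniq ?fset_uniq //= ?andbT.
    apply/hasPn => u uw; apply: contraTN dvw => uv.
    by apply/fdisjointP => /(_ u uv); rewrite uw.
  by move=> u; rewrite mem_cat in_fsetU.
rewrite big_cat /=; congr (_ * _); rewrite big_seq [RHS]big_seq.
  apply: eq_bigr => u uv; rewrite (cmM u v w).
  by move/fdisjointP: dvw => /(_ u uv); rewrite -cmE_eq0 => /eqP ->; rewrite addn0.
apply: eq_bigr => u uw; rewrite (cmM u v w).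
rewrite fdisjoint_sym in dvw.
by move/fdisjointP: dvw => /(_ u uw); rewrite -cmE_eq0 => /eqP ->; rewrite ?add0n.
Qed.

Definition usim (A : alphabet) (p q : upoly A) := ueval p = ueval q.

(* f_p(z) = E[e^(p z)] *)
Definition ugenf (A : alphabet) (p : upoly A) : nat -> K :=
  fun n => (n`!%:R^-1 : F) *: ueval (p ^+ n).

Definition dot_genf (A : alphabet) (p q : upoly A) : nat -> K :=
  fps_comp (ugenf p) (fps_log (ugenf q)).

(* (f, i) is the i-th of countably many pairwise distinct, similar umbrae
   attached to the series f. *)
Definition primary_umbra : choiceType :=
  ({f : nat -> K | f 0%N == 1} * nat)%type.

Definition primary_genf (u : primary_umbra) : nat -> K := val u.1.

Lemma primary_genf0 (u : primary_umbra) : primary_genf u 0%N = 1.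
Proof. exact/eqP/(valP u.1). Qed.

Definition primary : alphabet := Alphabet primary_genf0.

(* The umbrae of A together with a fresh auxiliary umbra for every pair of
   umbral polynomials over A; inr (p, q) is the dot-product umbra p . q *)
Definition dot_umbra (A : alphabet) : choiceType := (A + upoly A * upoly A)%type.

Definition dot_umbra_genf (A : alphabet) (u : dot_umbra A) : nat -> K :=
  match u with
  | inl v => genf v
  | inr (p, q) => dot_genf p q
  end.

Lemma dot_umbra_genf0 (A : alphabet) (u : dot_umbra A) :
  dot_umbra_genf u 0%N = 1.
Proof.
case: u => [v|[p q]] /=; first exact: genf0.
rewrite /dot_genf /fps_comp big_ord_recl big_ord0 addr0 /= /fps_one eqxx mulr1.
rewrite /ugenf fact0 invr1 scale1r expr0 /ueval.
rewrite mmapU /= mdom1 big_seq_fset0 mulr1 //.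
Qed.

Definition with_dot (A : alphabet) : alphabet :=
  Alphabet (@dot_umbra_genf0 A).

(* The umbrae obtained from the primary ones by l rounds of adjoining
   dot-product umbrae *)
Fixpoint stage (l : nat) : alphabet :=
  if l is l'.+1 then with_dot (stage l') else primary.

Definition keep (A : alphabet) (u : A) : upoly (with_dot A) :=
  @uvar (with_dot A) (inl u).

Definition dot (A : alphabet) (p q : upoly A) : upoly (with_dot A) :=
  @uvar (with_dot A) (inr (p, q)).

End Umbral.

(* Main.v *)
(* With d, g, a the generating series of delta, gamma, alpha and L = log a, the
   identity reads, after division by n!,
     [z^n] d g = [z^n] d
       + sum_(1 <= k <= n) 1/k [z^(n-k)] (d e^(k L)) [z^(k-1)] (g' e^(-k L)),
   which is Lagrange inversion: it expands g in powers of w = z e^L. Only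
   L(0) = 0 is used, never exp (log a) = a. By linearity in g it suffices to
   check g = w^j, where (e^(c L))' = c L' e^(c L) makes the residues collapse.
   Power series are represented by polynomials modulo a power of 'X. *)
Require Import Defs.
From mathcomp Require Import all_boot all_order all_algebra.
From mathcomp Require Import complex reals finmap.
From mathcomp.multinomials Require Import monalg mpoly.
From mathcomp Require Import ring zify.

Set Implicit Arguments.
Unset Strict Implicit.
Unset Printing Implicit Defensive.
Import GRing.Theory.
Local Open Scope ring_scope.

(** * Lagrange inversion modulo a power of ['X] *)

Section Lagrange.
Variables (F : fieldType) (K : comAlgType F).
Hypothesis charF : [pchar F] =i pred0.

Lemma natrS_neq0 k : k.+1%:R != 0 :> F.
Proof. by rewrite (proj1 (pcharf0P F) charF). Qed.

Lemma natr_scale k (x : K) : k%:R * x = (k%:R : F) *: x.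
Proof. by rewrite scaler_nat mulr_natl. Qed.

Lemma mulrSnI k : injective (fun x : K => k.+1%:R * x).
Proof.
by move=> x y; rewrite !natr_scale; apply/scalerI/natrS_neq0.
Qed.

(** Congruence modulo ['X ^+ N]. Differentiation lowers the modulus by one, hence the shifts between
    [N] and [N.+1] below. *)
Definition eqX N (p q : {poly K}) := forall i, (i < N)%N -> p`_i = q`_i.

Lemma eqX_trans N p q r : eqX N p q -> eqX N q r -> eqX N p r.
Proof. by move=> pq qr i lt_iN; rewrite pq ?qr. Qed.

Lemma eqXD N p p' q q' : eqX N p p' -> eqX N q q' -> eqX N (p + q) (p' + q').
Proof. by move=> pp' qq' i lt_iN; rewrite !coefD pp' ?qq'. Qed.

Lemma eqXM N p p' q q' : eqX N p p' -> eqX N q q' -> eqX N (p * q) (p' * q').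
Proof.
move=> pp' qq' i lt_iN; rewrite !coefM; apply: eq_bigr => j _.
by rewrite pp' ?qq' //; have := ltn_ord j; lia.
Qed.

Lemma eqXW M N p q : (M <= N)%N -> eqX N p q -> eqX M p q.
Proof. by move=> MN pq i iM; apply/pq/(leq_trans iM). Qed.

Lemma coef_exp_eq0 (p : {poly K}) j i : p`_0 = 0 -> (i < j)%N -> (p ^+ j)`_i = 0.
Proof.
move=> p0; elim: j i => // j IH i lt_ij.
rewrite exprS coefM big1 // => -[[|k] /= lt_k] _; first by rewrite p0 mul0r.
by rewrite IH ?mulr0 //; lia.
Qed.

(** The coefficient of degree i + 1 of a solution of y' = P y is fixed by the lower ones, since i +
    1 can be cancelled in characteristic 0. Identities between exponentials are derived from this
    uniqueness. *)
Lemma eqX_ode N (P y w : {poly K}) :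
  eqX N y^`() (P * y) -> eqX N w^`() (P * w) -> y`_0 = w`_0 -> eqX N.+1 y w.
Proof.
move=> dy dw yw0.
elim/ltn_ind => -[|i] IH lt_iN //; apply: (@mulrSnI i).
have:= dy i lt_iN; have := dw i lt_iN; rewrite !coef_deriv !mulr_natl => -> ->.
rewrite !coefM; apply: eq_bigr => j _.
by rewrite IH //; lia.
Qed.

(** * Truncated exponentials and the inversion formula *)

Variables (L : {poly K}) (N : nat).
Hypothesis L0 : L`_0 = 0.

Definition expc (c : K) j : K := (j`!%:R^-1 : F) *: c ^+ j.

(** This is e^(cL) without the powers of L beyond L^N. As L(0) = 0, those have order above N, so
    nothing is lost modulo ['X ^+ N.+1]. *)
Definition trexp (c : K) : {poly K} := \sum_(j < N.+1) (expc c j)%:P * L ^+ j.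

Lemma expcS c j : expc c j.+1 * j.+1%:R = c * expc c j.
Proof.
rewrite /expc mulrC natr_scale scalerA factS natrM invfM mulrA.
by rewrite mulfV ?natrS_neq0 // mul1r exprS scalerAr.
Qed.

Lemma coef0_trexp c : (trexp c)`_0 = 1.
Proof.
rewrite /trexp big_ord_recl coefD coef_sum big1 ?addr0.
  by rewrite coefCM /expc !expr0 fact0 invr1 scale1r coefC mulr1.
by move=> j _; rewrite coefCM coef_exp_eq0 // mulr0.
Qed.

(** Differentiation shifts the exponential sum and loses its last term, which is a multiple of L^N
    and so has order at least N. *)
Lemma deriv_trexp c : eqX N (trexp c)^`() (c%:P * L^`() * trexp c).
Proof.
have -> : (trexp c)^`() = c%:P * L^`() * (trexp c - (expc c N)%:P * L ^+ N).
  rewrite /trexp [in RHS]big_ord_recr /= addrK raddf_sum /=.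
  rewrite big_ord_recl /= derivM !derivC mul0r add0r mulr0 add0r.
  rewrite mulr_sumr; apply: eq_bigr => j _.
  rewrite derivM derivC mul0r add0r /bump leq0n add1n deriv_exp /=.
  rewrite -mulr_natr -[_%:R]polyC_natr.
  transitivity ((expc c j.+1 * j.+1%:R)%:P * L^`() * L ^+ j).
    by rewrite polyCM; ring.
  by rewrite expcS polyCM; ring.
apply: eqXM => // i lt_iN.
by rewrite coefB coefCM coef_exp_eq0 // mulr0 subr0.
Qed.

(** Both sides solve y' = (a + b) L' y with constant term 1. *)
Lemma trexpD a b : eqX N.+1 (trexp a * trexp b) (trexp (a + b)).
Proof.
apply: (eqX_ode _ (deriv_trexp _)); last first.
  by rewrite coefM big_ord_recl big_ord0 !coef0_trexp mulr1 addr0.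
rewrite derivM polyCD.
have -> : (a%:P + b%:P) * L^`() * (trexp a * trexp b) =
  a%:P * L^`() * trexp a * trexp b + trexp a * (b%:P * L^`() * trexp b) by ring.
by apply: eqXD; apply: eqXM => //; apply: deriv_trexp.
Qed.

Lemma trexp0 : eqX N.+1 (trexp 0) 1.
Proof.
apply: (eqX_ode (deriv_trexp _)); last by rewrite coef0_trexp coef1.
by rewrite derivC !mul0r.
Qed.

(* The residue computation behind Lagrange inversion: the coefficients of
   X^j exp(j L) in the "basis" (X exp(L))^k. *)
Lemma coef_lagrange_basis j k : (k < N)%N ->
  (('X ^+ j * trexp j%:R)^`() * trexp (- k.+1%:R))`_k = (j == k.+1)%:R * k.+1%:R.
Proof.
move=> lt_kN.
pose c : K := j%:R - k.+1%:R.
have -> : (('X ^+ j * trexp j%:R)^`() * trexp (- k.+1%:R))`_k =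
  ('X ^+ j.-1 * (trexp c *+ j) + 'X ^+ j * ((L^`() * trexp c) *+ j))`_k.
  have expB : eqX N (trexp j%:R * trexp (- k.+1%:R)) (trexp c).
    by apply: eqXW (trexpD _ _).
  apply: (_ : eqX N _ _) lt_kN; rewrite derivM derivXn mulrDl.
  apply: eqXD.
    rewrite mulrnAr -mulrnAl -mulrA.
    exact: eqXM.
  apply: (@eqX_trans _ _
      ('X ^+ j * (j%:R%:P * L^`() * trexp j%:R) * trexp (- k.+1%:R))).
    by apply: eqXM => //; apply: eqXM => //; apply: deriv_trexp.
  have -> : 'X ^+ j * (j%:R%:P * L^`() * trexp j%:R) * trexp (- k.+1%:R) =
    'X ^+ j * j%:R%:P * L^`() * (trexp j%:R * trexp (- k.+1%:R)) by ring.
  have -> : 'X ^+ j * ((L^`() * trexp c) *+ j) =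
    'X ^+ j * j%:R%:P * L^`() * trexp c.
    by rewrite polyC_natr -[_ *+ j]mulr_natr; ring.
  exact: eqXM.
rewrite coefD !coefXnM !coefMn.
case: j @c => [|j] c /=; first by rewrite !mulr0n ?if_same addr0 mul0r.
rewrite eqSS !ltnS.
case: ltngtP => [lt_kj|lt_jk|eq_jk]; first by rewrite addr0 mul0r.
- rewrite mul0r -mulrnDl.
  (* The old [j] is now [j.+1], so c = -(k - j). Comparing (e^(cL))' = c L' e^(cL) in degree k - j -
     1 and cancelling k - j gives the claim. *)
  suff -> : (trexp c)`_(k - j) = - (L^`() * trexp c)`_(k - j.+1).
    by rewrite addNr mul0rn.
  have [i eq_i] : exists i, (k - j = i.+1)%N by exists (k - j).-1; lia.
  have -> : (k - j.+1 = i)%N by lia.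
  have cE : c = - i.+1%:R.
    rewrite /c -eq_i natrB ?(ltnW lt_jk) //.
    by rewrite -(natr1 j) -(natr1 k); ring.
  rewrite eq_i; apply: (@mulrSnI i) => /=.
  have /(_ i) := deriv_trexp c; rewrite coef_deriv mulr_natl => -> //; last by lia.
  by rewrite -mulrA coefCM cE; ring.
- by rewrite eq_jk subnn coef0_trexp addr0 mul1r.
Qed.

(* Both sides are linear in G, so it suffices to treat G = X^j exp(j L). *)
Theorem lagrange_inversion (D G : {poly K}) :
  (D * G)`_N = D`_N * G`_0 + \sum_(k < N) (k.+1%:R^-1 : F) *:
    ((D * trexp k.+1%:R)`_(N - k.+1) * (G^`() * trexp (- k.+1%:R))`_k).
Proof.
pose rhs (G : {poly K}) := D`_N * G`_0 + \sum_(k < N) (k.+1%:R^-1 : F) *: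
    ((D * trexp k.+1%:R)`_(N - k.+1) * (G^`() * trexp (- k.+1%:R))`_k).
rewrite -/(rhs G).
have rhsD c P Q : rhs (c%:P * P + Q) = c * rhs P + rhs Q.
  rewrite /rhs mulrDr mulr_sumr addrACA -big_split /=; congr (_ + _).
    by rewrite coefD coefCM; ring.
  apply: eq_bigr => k _; rewrite derivD derivM derivC mul0r add0r.
  rewrite mulrDl coefD -mulrA coefCM -scalerAr -scalerDr; congr (_ *: _).
  by ring.
have rhsX j : (j <= N)%N -> (D * ('X ^+ j * trexp j%:R))`_N = rhs ('X ^+ j * trexp j%:R).
  move=> le_jN; rewrite /rhs.
  under eq_bigr => k _ do rewrite coef_lagrange_basis //.
  have -> : (D * ('X ^+ j * trexp j%:R))`_N = (D * trexp j%:R)`_(N - j).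
    by rewrite mulrCA coefXnM ltnNge le_jN.
  (* For exponent 0 only the constant-term summand survives. For exponent j + 1 only the summand of
     index j does, and its weight 1/(j + 1) cancels the factor from [coef_lagrange_basis]. *)
  case: j le_jN => [|j] lt_jN.
    rewrite big1 ?addr0 => [|k _]; last by rewrite mul0r mulr0 scaler0.
    rewrite subn0 expr0 mul1r coef0_trexp mulr1.
    have : eqX N.+1 (D * trexp 0) (D * 1) by apply: eqXM => //; apply: trexp0.
    by rewrite mulr1; apply.
  rewrite coefXnM mulr0 add0r (bigD1 (Ordinal lt_jN)) //= big1 ?addr0.
    rewrite eqxx mul1r [_ * j.+1%:R]mulrC natr_scale scalerA.
    by rewrite mulVf ?natrS_neq0 // scale1r.
  move=> k /negP neq_kj; case: eqP => [[eq_jk]|_]; last by rewrite mul0r mulr0 scaler0.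
  by case: neq_kj; apply/eqP/val_inj.
(* [q] is a lower bound for the order of [P], and [p] counts the coefficients up to degree [N] that
   may still be nonzero. At p = 0 both sides vanish. *)
suff vanish p q (P : {poly K}) : (q <= N.+1)%N -> (forall i, (i < q)%N -> P`_i = 0) ->
    p = (N.+1 - q)%N -> (D * P)`_N = rhs P by exact: (@vanish N.+1 0%N).
elim: p q P => [|p IH] q {}G le_qN G0 def_p.
  have eqG : eqX N.+1 G 0 by move=> i lt_i; rewrite coef0 G0 //; lia.
  rewrite /rhs eqG // coef0 mulr0 add0r big1 => [|k _].
    have : eqX N.+1 (D * G) (D * 0) by apply: eqXM.
    by move=> -> //; rewrite mulr0 coef0.
  have : eqX N (G^`() * trexp (- k.+1%:R)) (0 * trexp (- k.+1%:R)).
    by apply: eqXM => // i lt_iN; rewrite coef_deriv eqG // !coef0 mul0rn.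
  by move=> -> //; rewrite mul0r coef0 mulr0 scaler0.
have le_q : (q <= N)%N by lia.
(* [B] starts with X^q with coefficient 1, so subtracting a multiple of it raises the order of
   [G]. *)
pose B := 'X ^+ q * trexp q%:R.
have -> : G = (G`_q)%:P * B + (G - (G`_q)%:P * B) by rewrite addrC subrK.
rewrite rhsD -rhsX // -(IH q.+1); last 3 first.
- by lia.
- move=> i; rewrite ltnS leq_eqVlt coefB coefCM coefXnM => /orP[/eqP ->|lt_iq].
    by rewrite ltnn subnn coef0_trexp mulr1 subrr.
  by rewrite lt_iq (G0 i) //= mulr0 subrr.
- by lia.
by rewrite -coefCM -coefD mulrDr mulrCA.
Qed.

End Lagrange.

(** * Evaluation of sums and products of umbrae *)

Section UmbralEvaluation.
Variables (F : fieldType) (K : comAlgType F).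
Hypothesis charF : [pchar F] =i pred0.
Implicit Types A : alphabet K.
Local Notation upoly A := {malg K[{cmonom (umbra A)}]}.

Lemma ueval0 A : ueval (0 : upoly A) = 0.
Proof.
have := ueval_linear (-1) (0 : upoly A) 0.
by rewrite scaler0 addr0 mulN1r addNr.
Qed.

Lemma uevalD A (p q : upoly A) : ueval (p + q) = ueval p + ueval q.
Proof. by rewrite -[p]scale1r ueval_linear mul1r scale1r. Qed.

Lemma uevalZ A c (p : upoly A) : ueval (c *: p) = c * ueval p.
Proof. by rewrite -[c *: p]addr0 ueval_linear ueval0 addr0. Qed.

Lemma uevalMn A (p : upoly A) k : ueval (p *+ k) = ueval p *+ k.
Proof. by rewrite -scaler_nat uevalZ mulr_natl. Qed.

Lemma ueval_sum A I (r : seq I) (f : I -> upoly A) :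
  ueval (\sum_(i <- r) f i) = \sum_(i <- r) ueval (f i).
Proof. exact: (big_morph _ (@uevalD A) (ueval0 A)). Qed.

Lemma ueval1 A : ueval (1 : upoly A) = 1.
Proof. by rewrite /ueval mmapU /= mdom1 big_seq_fset0 mulr1. Qed.

(** E[e^(cz)] = e^(cz), which turns a dot product with a scalar into exp(c log f). *)
Lemma ugenf_scalar A (c : K) : ugenf (c%:A : upoly A) =1 expc c.
Proof.
by move=> j; rewrite /ugenf exprZn expr1n uevalZ ueval1 mulr1.
Qed.

Lemma monoM A (v w : {cmonom A}) :
  << v >> * << w >> = << mmul v w >> :> upoly A.
Proof. by rewrite malgM_def fgmulUU mulr1. Qed.

(** The support bound supplies the disjointness required by [ueval_uncorrelated]. *)
Lemma uvarX_mono A (u : A) n :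
  exists2 w : {cmonom A}, uvar u ^+ n = << w >> & (finsupp w `<=` [fset u])%fset.
Proof.
elim: n => [|n [w Ew sw]]; first by exists mone => //; rewrite mdom1 fsub0set.
exists (mmul (ucm u) w).
  by rewrite exprS Ew; exact: monoM.
by rewrite (mdomD (ucm u) w) mdomU fsubUset fsubset_refl.
Qed.

Lemma ueval_uvar_prod A (s : seq (A * nat)) : uniq (unzip1 s) ->
  ueval (\prod_(x <- s) uvar x.1 ^+ x.2) =
    \prod_(x <- s) (x.2`!%:R * genf x.1 x.2).
Proof.
(* Uncorrelation is available for monomials only, so the induction also carries the product as one
   monomial with controlled support. *)
move=> us; suff [] : ueval (\prod_(x <- s) uvar x.1 ^+ x.2) =
    \prod_(x <- s) (x.2`!%:R * genf x.1 x.2) /\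
  exists2 w : {cmonom A}, \prod_(x <- s) uvar x.1 ^+ x.2 = << w >> &
    {subset finsupp w <= unzip1 s} by [].
elim: s us => [_|[u n] s IH /= /andP[us /IH [Es [w Ew sw]]]].
  rewrite !big_nil; split; first exact: ueval1.
  by exists mone => // u; rewrite mdom1 inE.
have [v Ev /fsubsetP sv] := uvarX_mono u n.
rewrite !big_cons /= -Es Ew Ev -ueval_uvarX; split.
  rewrite ueval_uncorrelated ?Ev //.
  apply/fdisjointP => x /sv; rewrite in_fset1 => /eqP ->.
  by apply: contra us => /sw.
exists (mmul v w); first exact: monoM.
move=> x; rewrite (mdomD v w) in_fsetU inE => /orP[/sv|/sw ->]; last by rewrite orbT.
by rewrite in_fset1 => ->.
Qed.

(** The binomial coefficient absorbs the factorials of the two moments into n!, leaving a Cauchy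
    product. *)
Lemma ueval_addX A (x y : A) n : uniq [:: x; y] ->
  ueval ((uvar x + uvar y) ^+ n) =
    n`!%:R * \sum_(i < n.+1) genf x (n - i)%N * genf y i.
Proof.
move=> uxy; rewrite exprDn ueval_sum mulr_sumr; apply: eq_bigr => i _.
have := @ueval_uvar_prod A [:: (x, (n - i)%N); (y, nat_of_ord i)] uxy.
rewrite !big_cons !big_nil /= !mulr1 uevalMn => ->.
rewrite -(bin_fact (leq_ord i)) !natrM -mulr_natl.
ring.
Qed.

Lemma exprDn_mul (S : comNzRingType) (x y z t : S) a b :
  (x + y) ^+ a * (z * (z + t) ^+ b) = \sum_(i < a.+1) \sum_(j < b.+1)
    (x ^+ (a - i) * (y ^+ i * (z ^+ (b - j).+1 * t ^+ j)))
      *+ ('C(a, i) * 'C(b, j)).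
Proof.
rewrite !exprDn mulr_suml; apply: eq_bigr => i _.
rewrite !mulr_sumr; apply: eq_bigr => j _.
by rewrite exprS !mulrnAr !mulrnAl -mulrnA mulnC !mulrA.
Qed.

(** The extra factor z raises the exponent b - j by one. Its moment then carries (b - j + 1)! = (b -
    j + 1) (b - j)!, and the surplus factor produces the coefficients of the derivative of the
    series of z. *)
Lemma ueval_addX_mul A (x y z t : A) a b : uniq [:: x; y; z; t] ->
  ueval ((uvar x + uvar y) ^+ a * (uvar z * (uvar z + uvar t) ^+ b)) =
    a`!%:R * (\sum_(i < a.+1) genf x (a - i)%N * genf y i) *
    (b`!%:R * (\sum_(j < b.+1) (genf z (b - j).+1 *+ (b - j).+1) * genf t j)).
Proof.
move=> uxyzt; rewrite exprDn_mul ueval_sum.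
rewrite [a`!%:R * _]mulr_sumr mulr_suml; apply: eq_bigr => i _.
rewrite !mulr_sumr ueval_sum; apply: eq_bigr => j _.
have := @ueval_uvar_prod A [:: (x, (a - i)%N); (y, nat_of_ord i);
  (z, (b - j).+1); (t, nat_of_ord j)] uxyzt.
rewrite !big_cons !big_nil /= !mulr1 uevalMn => ->.
rewrite -(bin_fact (leq_ord i)) -(bin_fact (leq_ord j)).
by rewrite factS -mulr_natl !natrM -mulr_natl; ring.
Qed.

(** * From coefficient sequences to truncated polynomials *)

Lemma fps_exp_coef (f : nat -> K) N j n : (n < N)%N ->
  fps_exp f j n = ((\poly_(i < N) f i) ^+ j)`_n.
Proof.
elim: j n => [|j IH] n lt_nN; first by rewrite expr0 coef1.
rewrite /fps_exp iterS -/(fps_exp f j) exprS coefM; apply: eq_bigr => i _.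
have lt_iN : (i < N)%N by have := ltn_ord i; lia.
by rewrite IH ?coef_poly ?lt_iN //; have := ltn_ord i; lia.
Qed.

Lemma fps_log0 (g : nat -> K) : fps_log g 0%N = 0.
Proof. by rewrite /fps_log /fps_comp big_ord_recl big_ord0 mul0r addr0. Qed.

(** The composition stops at the power n of the logarithm and [trexp] at N; the powers in between
    have order above n. *)
Lemma dot_genf_scalar A (c : K) (q : upoly A) N n : (n <= N)%N ->
  dot_genf c%:A q n =
    (trexp (\poly_(i < N.+1) fps_log (ugenf q) i) N c)`_n.
Proof.
move=> le_nN; rewrite /dot_genf /fps_comp /trexp coef_sum.
rewrite (big_ord_widen N.+1 (fun j => ugenf c%:A j *
  fps_exp (fps_log (ugenf q)) j n)) // big_mkcond.
apply: eq_bigr => j _; rewrite coefCM ugenf_scalar.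
case: ltnP => [_|lt_nj]; first by rewrite (@fps_exp_coef _ N.+1).
by rewrite coef_exp_eq0 ?mulr0 // coef_poly fps_log0.
Qed.

(** Makes the auxiliary umbrae for k and -k distinct, hence uncorrelated. Evaluating the sum of the
    two scalars gives a positive integer, nonzero in characteristic 0. *)
Lemma natrS_neq_opp A k : (k.+1%:R : upoly A) != - k.+1%:R.
Proof.
rewrite -addr_eq0 -natrD; apply/eqP => /(congr1 (@ueval F K A)) /eqP.
rewrite uevalMn ueval1 ueval0 -[_ *+ _]mulr1 natr_scale scaler_eq0 oner_eq0 orbF.
by rewrite addSn (negbTE (natrS_neq0 charF _)).
Qed.

Theorem umbral_abel A (alpha gamma delta : A) n : gamma != delta ->
  usim ((keep delta + keep gamma) ^+ n)
    (\sum_(k < n.+1)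
       'C(n, k)%:R *
       (if k == 0%N :> nat then keep delta ^+ n
        else (keep delta + dot k%:R (uvar alpha)) ^+ (n - k) *
             (keep gamma *
              (keep gamma + dot (- k%:R) (uvar alpha)) ^+ (k - 1)))).
Proof.
move=> neq_gd; rewrite /usim.
(* Only coefficients of degree at most n occur, so all three series are cut there. *)
pose L := \poly_(i < n.+1) fps_log (ugenf (uvar alpha)) i.
pose D := \poly_(i < n.+1) genf delta i.
pose G := \poly_(i < n.+1) genf gamma i.
have L0 : L`_0 = 0 by rewrite coef_poly fps_log0.
have G0 : G`_0 = 1 by rewrite coef_poly genf0.
have udg : uniq [:: (inl delta : with_dot A); inl gamma].
  by rewrite /= inE eq_sym (inj_eq inl_inj) neq_gd.
rewrite /keep ueval_addX //= ueval_sum.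
have -> : \sum_(i < n.+1) genf delta (n - i)%N * genf gamma i = (D * G)`_n.
  rewrite coefMr; apply: eq_bigr => i _.
  by rewrite !coef_poly ltn_ord ltnS leq_subr.
rewrite (lagrange_inversion charF _ L0) G0 mulr1 mulrDr.
(* The k = 0 summand matches the term D_n G_0, where G_0 = 1. *)
rewrite [RHS]big_ord_recl; congr (_ + _).
  by rewrite [X in ueval X]/= bin0 [1 * _]mul1r ueval_uvarX coef_poly ltnSn.
rewrite mulr_sumr; apply: eq_bigr => k _.
rewrite lift0 [X in ueval (_ * X)]/=.
have lt_kn := ltn_ord k.
rewrite [X in ueval X]mulr_natl uevalMn /dot ueval_addX_mul; last first.
  by rewrite /= !inE !(inj_eq inl_inj) !(inj_eq inr_inj) /= xpair_eqE
    (negbTE (natrS_neq_opp _ _)) eq_sym (negbTE neq_gd).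
rewrite subn1 /=.
have -> : \sum_(i < (n - k.+1).+1) genf delta (n - k.+1 - i)%N *
    dot_genf k.+1%:R (uvar alpha) i = (D * trexp L n k.+1%:R)`_(n - k.+1).
  rewrite coefMr; apply: eq_bigr => i _; have lt_i := ltn_ord i.
  rewrite coef_poly (_ : (_ < n.+1)%N); last by lia.
  (* The numeral in the umbral ring is rewritten as a scalar multiple of 1 to fit
     [dot_genf_scalar]. *)
  by rewrite -(@scaler_nat K) (@dot_genf_scalar _ _ _ n) //; lia.
have -> : \sum_(j < k.+1) genf gamma (k - j).+1 *+ (k - j).+1 *
    dot_genf (- k.+1%:R) (uvar alpha) j = (G^`() * trexp L n (- k.+1%:R))`_k.
  rewrite coefMr; apply: eq_bigr => i _; have lt_i := ltn_ord i.
  rewrite coef_deriv coef_poly (_ : (_ < n.+1)%N); last by lia.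
  by rewrite -(@scaler_nat K) -scaleNr (@dot_genf_scalar _ _ _ n) //; lia.
set X := nth 0 _ (n - k.+1); set Y := nth 0 _ k.
(* Here n! splits as C(n, k + 1) (k + 1) k! (n - k - 1)!, and the factor k + 1 cancels the Lagrange
   weight 1/(k + 1). *)
rewrite -(@bin_fact n k.+1) // factS mulrACA -[RHS]mulr_natl.
have -> x : ('C(n, k.+1) * (k.+1 * k`! * (n - k.+1)`!))%:R * x =
    ('C(n, k.+1) * ((n - k.+1)`! * k`!))%:R * (k.+1%:R * x) :> K.
  by rewrite !natrM; ring.
rewrite [k.+1%:R * _]natr_scale scalerA mulfV ?natrS_neq0 // scale1r !natrM.
by rewrite !mulrA.
Qed.

End UmbralEvaluation.

(** [R[i]] is the field of complex numbers and [m] the number of variables; the three umbrae may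
    themselves be dot products nested up to depth [l]. *)
Theorem mainTheorem2 (R : realType) (m l : nat)
    (alpha gamma delta : stage {mpoly R[i][m]} l)
    (distinct : uniq [:: alpha; gamma; delta]) (n : nat) :
  usim ((keep delta + keep gamma) ^+ n)
    (\sum_(k < n.+1)
       'C(n, k)%:R *
       (if k == 0%N :> nat then keep delta ^+ n
        else (keep delta + dot k%:R (uvar alpha)) ^+ (n - k) *
             (keep gamma *
              (keep gamma + dot (- k%:R) (uvar alpha)) ^+ (k - 1)))).
Proof.
apply: umbral_abel; first exact: Num.Theory.pchar_num.
by move: distinct; rewrite /= !inE => /and3P[].
Qed.
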